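(* Let $(X_t)_{t\ge 0}$ be a regular jump Lévy process in $\mathbf{R}^d$ and let $V$ be a confining $X$-Kato class potential with Feynman--Kac semigroup $\{T_t: t\ge0\}$ (all terms as defined in the context). Suppose that for every $R>0$, $\log\nu\in L^1(B(0,R)^c,\nu(x)dx)$, and that the jump intensity $\nu$ and the potential $V$ are continuous functions. Then $V$ is a borderline potential for AGSD/AIUC of $\{T_t: t\ge0\}$ if and only if there exist $t_0>0$ and $R>0$ such that $F^{t_0V}_A(\nu)=0$ for all Borel sets $A\subset B(0,R)^c$.
   Context: Conventions. $(X_t)_{t\ge0}$ is a Lévy process in $\mathbf{R}^d$, $d\ge1$; $\mathbf{P}^x,\mathbf{E}^x$ refer to the process started at $x$. $B(x,r)$ is the open ball. $C, C_i$ denote positive constants; $C(X,a,\dots)$ depends only on the process (and the dimension $d$) and on the listed parameters. $f\asymp Cg$ means $C^{-1}g\le f\le Cg$. Regular jump Lévy process: a Lévy process satisfying (A1)--(A3). (A1) $(X_t)$ is symmetric, its Lévy measure is absolutely continuous with a strictly positive density $\nu$ (on $\mathbf{R}^d\setminus\{0\}$; the jump intensity), and: (1) for every $0<r\le 1/2$ there is $C_1=C_1(X,r)\ge1$ with $\nu(x)\asymp C_1\nu(y)$ for $r\le|y|\le|x|\le|y|+1$; (2) there is $C_2=C_2(X)\ge1$ with $\nu(x)\le C_2\nu(y)$ for $1/2\le|y|\le|x|$; (3) there is $C_3=C_3(X)\ge1$ with $\int_{|z-x|>1/2,\,|z-y|>1/2}\nu(x-z)\nu(z-y)\,dz\le C_3\nu(x-y)$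 for $|y-x|\ge1$. (A2) $(X_t)$ is strong Feller, equivalently it has transition densities $p(t,x,y)=p(t,y-x)$ for $t>0$; moreover there are $t_b>0$ and a constant $C(X,t_b)$ with $0<p(t_b,x)\le C(X,t_b)$ for all $x\in\mathbf{R}^d$. (A3) For all $0<p<q<R\le1$, $\sup_{x\in B(0,p)}\sup_{y\in B(0,q)^c}G_{B(0,R)}(x,y)<\infty$, where for a bounded open set $D$, $G_D(x,y)=\int_0^\infty p_D(t,x,y)\,dt$ for $x,y\in D$ (and $0$ otherwise), and $p_D$ is the transition density of the process killed upon exiting $D$. Potentials. A Borel function $V:\mathbf{R}^d\to\mathbf{R}$ belongs to $\mathcal{K}^X$ if $\lim_{t\to0}\sup_x\mathbf{E}^x[\int_0^t|V(X_s)|ds]=0$, and to $\mathcal{K}^X_{\mathrm{loc}}$ if $V\mathbf{1}_B\in\mathcal{K}^X$ for every ball $B$. $V$ is an $X$-Kato class potential if $V_-\in\mathcal{K}^X$ and $V_+\in\mathcal{K}^X_{\mathrm{loc}}$. It is confining if also $V(x)\to\infty$ as $|x|\to\infty$. Feynman--Kac semigroup: $T_tf(x)=\mathbf{E}^x[e^{-\int_0^tV(X_s)ds}f(X_t)]$, $t>0$. Borderline potential: $V$ is called a borderline potential for (A)GSD/(A)IUC of $\{T_t\}$ if there exist $t_0>0$ and $R>0$ such that $t_0V(x)=|\log\nu(x)|$ for every $x\in B(0,R)^c$. (This is the full definition; AGSD and AIUC, asymptotic ground state domination and asymptotic intrinsic ultracontractivity, enter only through the name.) Free energy: for a Borel set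 $A$ with $\mathrm{dist}(A,0)>0$ let $E^V_A(\nu)=\int_AV(x)\nu(x)\,dx$, $H_A(\nu)=-\int_A\nu(x)\log\nu(x)\,dx$ and $F^V_A(\nu)=E^V_A(\nu)-H_A(\nu)$ ($F^{tV}_A$ is the functional with $V$ replaced by $tV$). *)

(* Defs.v *)
From HB Require Import structures.
From mathcomp Require Import all_boot all_order all_algebra.
From mathcomp Require Import all_classical all_reals all_analysis.
From mathcomp Require Import measurable_realfun.
Set Implicit Arguments.
Unset Strict Implicit.
Unset Printing Implicit Defensive.
Import Order.TTheory GRing.Theory Num.Theory.
Import numFieldNormedType.Exports.
Local Open Scope classical_set_scope.
Local Open Scope ring_scope.

HB.instance Definition _ (R : realType) (d : nat) :=
  Measurable.copy 'rV[R]_d (g_sigma_algebraType (@open 'rV[R]_d)).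

Lemma open_measurable_rV (R : realType) (d : nat) (A : set 'rV[R]_d) :
  open A -> measurable A.
Proof. by move=> oA; exact: sub_sigma_algebra. Qed.

Lemma open_rV_bigcup (R : realType) (d : nat) (A : set 'rV[R]_d) :
  open A ->
  A = \bigcup_(q in [set q : 'rV[rat]_d * rat |
         ball (\row_i ratr (q.1 ord0 i) : 'rV[R]_d) (ratr q.2) `<=` A])
       ball (\row_i ratr (q.1 ord0 i) : 'rV[R]_d) (ratr q.2).
Proof.
move=> oA; apply/seteqP; split => [x Ax|x [q /= qA xq]]; last exact: qA.
have /nbhs_ballP[e /= e0 eA] : nbhs x A by exact: open_nbhs_nbhs.
have e20 : 0 < e / 2 by rewrite divr_gt0.
have [r /[!in_itv]/= /andP[r0 re]] := rat_in_itvoo e20.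
have /choice[f fP] : forall i, exists q : rat, `|x ord0 i - ratr q| < ratr r.
  move=> i; have [|q] := @rat_in_itvoo R (x ord0 i - ratr r) (x ord0 i + ratr r).
    by rewrite ltrBlDr -addrA ltrDl addr_gt0.
  by rewrite in_itv/= => qP; exists q; rewrite ltr_distlC.
have xf : ball (\row_i ratr (f i) : 'rV[R]_d) (ratr r) x.
  by split => // i j; rewrite !mxE ord1 /ball/= distrC.
have fE : (\row_i ratr ((\row_i f i) ord0 i) : 'rV[R]_d) = \row_i ratr (f i).
  by apply/rowP => i; rewrite !mxE.
exists (\row_i f i, r); rewrite /= fE // => y fy; apply: eA.
apply: (@ball_splitr _ _ (\row_i ratr (f i) : 'rV[R]_d)).
  by apply: le_ball xf; exact: ltW.
by apply: le_ball fy; exact: ltW.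
Qed.

Lemma measurable_rV d (T : measurableType d) (R : realType) (n : nat)
    (f : T -> 'rV[R]_n) :
  (forall i, measurable_fun setT (fun x => f x ord0 i)) ->
  measurable_fun setT f.
Proof.
move=> mf; apply: (@measurability _ _ _ _ setT f (@open 'rV[R]_n)) => //.
move=> _ [A oA <-]; rewrite setTI (open_rV_bigcup oA) preimage_bigcup.
rewrite bigcup_mkcond; apply: countable_bigcupT_measurable => [|[q r]].
  exact: countableP.
case: ifPn => _; last exact: measurable0.
have [r0|r0] := leP (ratr r : R) 0.
  rewrite (_ : _ @^-1` _ = set0); first exact: measurable0.
  by rewrite -subset0 => x [/=]; rewrite ltNge r0.
rewrite (_ : _ @^-1` _ = \bigcap_(i in [set: 'I_n])
    ((fun x => f x ord0 i) @^-1` ball (ratr (q ord0 i) : R) (ratr r))).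
  apply: fin_bigcap_measurable; first exact: finite_finset.
  move=> i _; rewrite -[X in measurable X]setTI.
  by apply: mf => //; apply: open_measurable; exact: ball_open.
apply/seteqP; split => x /= xq.
  by move=> i _; case: xq => _ /(_ ord0 i); rewrite mxE.
by split => // i j; rewrite !mxE (ord1 i); exact: (xq j I).
Qed.

Lemma measurable_coord (R : realType) (n : nat) (i : 'I_n) :
  measurable_fun setT (fun x : 'rV[R]_n => x ord0 i).
Proof.
apply: (measurability (@RGenOInfty.G R)) => [|/= _ [_] [r] -> <-].
  exact: RGenOInfty.measurableE.
rewrite setTI; apply: open_measurable_rV.
have /continuousP := @coord_continuous R 1 n ord0 i; apply.
by rewrite set_itv_o_infty; exact: open_gt.
Qed.

Definition cons_rV (R : realType) (d : nat) (x : R * 'rV[R]_d) : 'rV[R]_d.+1 :=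
  row_mx x.1%:M x.2.

Lemma measurable_cons_rV (R : realType) (d : nat) :
  measurable_fun setT (@cons_rV R d).
Proof.
apply: measurable_rV => i; rewrite /cons_rV.
have [j ij|j ij] := split_ordP (i : 'I_(1 + d)).
  rewrite (_ : (fun _ => _) = fst); first exact: measurable_fst.
  apply/funext => x; rewrite ij; apply: (etrans (row_mxEl _ _ _ _)).
  by rewrite (ord1 j) mxE eqxx mulr1n.
rewrite (_ : (fun _ => _) = (fun y : 'rV[R]_d => y ord0 j) \o snd).
  by apply: measurableT_comp; [exact: measurable_coord|exact: measurable_snd].
by apply/funext => x; rewrite ij; exact: row_mxEr.
Qed.

(* The image under [cons_rV] of the product of the Lebesgue measure on [R]
   with a measure on [R^d]. *)
Definition lebesgue_cons (R : realType) (d : nat)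
    (mu : {sigma_finite_measure set 'rV[R]_d -> \bar R}) :
    set 'rV[R]_d.+1 -> \bar R :=
  pushforward (@lebesgue_measure R \x mu)%E (@cons_rV R d).

Section lebesgue_cons.
Variables (R : realType) (d : nat)
  (mu : {sigma_finite_measure set 'rV[R]_d -> \bar R}).

Let mcons : {measure set 'rV[R]_d.+1 -> \bar R} :=
  measure_function_pushforward__canonical__measure_function_Measure
    (@lebesgue_measure R \x mu)%E (@measurable_cons_rV R d).

HB.instance Definition _ := Measure.copy (lebesgue_cons mu) mcons.

Let lebesgue_cons_sigma_finite : sigma_finite setT (lebesgue_cons mu).
Proof.
have [F TF Foo] : sigma_finite setT (@lebesgue_measure R \x mu)%E.
  have /sigma_finiteP[F [TF ndF Foo]] := sigma_finiteT (@lebesgue_measure R).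
  have /sigma_finiteP[G [TG ndG Goo]] := sigma_finiteT mu.
  exists (fun n => F n `*` G n).
    rewrite -setXTT TF TG predeqE => -[x y]; split.
      move=> [/= [n _ Fnx] [k _ Gky]]; exists (maxn n k) => //; split.
      - by move: x Fnx; exact/subsetPset/ndF/leq_maxl.
      - by move: y Gky; exact/subsetPset/ndG/leq_maxr.
    by move=> [n _ []/= ? ?]; split; exists n.
  move=> k; have [? ?] := Foo k; have [? ?] := Goo k.
  split; first exact: measurableX.
  by rewrite product_measure1E// lte_mul_pinfty// ge0_fin_numE.
exists (fun n => [set y : 'rV[R]_d.+1 |
  F n (y ord0 ord0, \row_i (y ord0 (lift ord0 i)))]).
  apply/seteqP; split => // y _.
  have : [set: R * 'rV[R]_d] (y ord0 ord0, \row_i (y ord0 (lift ord0 i))) by [].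
  by rewrite TF => -[n _ Fn]; exists n.
move=> n; have [mF Fn] := Foo n; split.
  rewrite -[X in measurable X]setTI.
  have : measurable_fun setT (fun y : 'rV[R]_d.+1 =>
      (y ord0 ord0, \row_i (y ord0 (lift ord0 i)))).
    apply/measurable_fun_pair => /=; first exact: measurable_coord.
    apply: measurable_rV => i.
    rewrite (_ : (fun _ => _) = (fun y : 'rV[R]_d.+1 => y ord0 (lift ord0 i))).
      exact: measurable_coord.
    by apply/funext => y; rewrite mxE.
  by apply.
rewrite /lebesgue_cons /pushforward (_ : _ @^-1` _ = F n) //.
have consE (x : R * 'rV[R]_d) :
    (cons_rV x ord0 ord0, \row_i (cons_rV x ord0 (lift ord0 i))) = x.
  case: x => x y; congr pair.
    have -> : @ord0 d = @lshift 1 d ord0 by exact/val_inj.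
    by apply: (etrans (row_mxEl _ _ _ _)); rewrite mxE eqxx mulr1n.
  apply/rowP => i; rewrite mxE.
  have -> : lift (@ord0 d) i = @rshift 1 d i by exact/val_inj.
  exact: row_mxEr.
by apply/seteqP; split => x /=; rewrite consE.
Qed.

HB.instance Definition _ := Measure_isSigmaFinite.Build _ _ _
  (lebesgue_cons mu) lebesgue_cons_sigma_finite.
End lebesgue_cons.

Fixpoint lebesgue_rV (R : realType) (d : nat) :
    {sigma_finite_measure set 'rV[R]_d -> \bar R} :=
  if d is d'.+1 then lebesgue_cons (lebesgue_rV R d') else \d_(0 : 'rV[R]_0).

Lemma lebesgue_rV_box (R : realType) (d : nat) (A : 'I_d -> set R) :
  (forall i, measurable (A i)) ->
  lebesgue_rV R d [set x | forall i, A i (x ord0 i)] =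
  (\prod_(i < d) lebesgue_measure (A i))%E.
Proof.
elim: d A => [|d IH] A mA /=.
  by rewrite big_ord0 diracE mem_set // => -[].
rewrite big_ord_recl -IH => [|i]; last exact: mA.
pose B := [set x : 'rV[R]_d | forall i, A (lift ord0 i) (x ord0 i)].
have mB : measurable B.
  rewrite (_ : B = \bigcap_(i in [set: 'I_d])
      ((fun x : 'rV[R]_d => x ord0 i) @^-1` A (lift ord0 i))).
    apply: fin_bigcap_measurable; first exact: finite_finset.
    by move=> i _; rewrite -[X in measurable X]setTI; exact: measurable_coord.
  by apply/seteqP; split => x /= xA i; [move=> _|]; exact: xA.
apply: etrans (product_measure1E lebesgue_measure _ (mA ord0) mB).
congr (product_measure1 _ _ _); apply/seteqP; split => -[x y] /=.
  move=> xyA; split=> [|i].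
    move: (xyA ord0); have -> : @ord0 d = @lshift 1 d ord0 by exact/val_inj.
    by rewrite /cons_rV (row_mxEl x%:M y) mxE eqxx mulr1n.
  move: (xyA (lift ord0 i)); congr (A _ _).
  have -> : lift (@ord0 d) i = @rshift 1 d i by exact/val_inj.
  exact: (row_mxEr x%:M y).
move=> [xA yA] i; have [j ->|j ->] := split_ordP (i : 'I_(1 + d)).
  rewrite /cons_rV (row_mxEl x%:M y) (ord1 j) mxE eqxx mulr1n.
  by have -> : @lshift 1 d 0 = @ord0 d by exact/val_inj.
rewrite /cons_rV (row_mxEr x%:M y).
have -> : @rshift 1 d j = lift (@ord0 d) j by exact/val_inj.
exact: yA.
Qed.

(* The norm [`|x|] of the library on ['rV[R]_d] is the sup norm, hence this
   Euclidean norm; both induce the same topology. *)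
Definition dot (R : realType) (d : nat) (x y : 'rV[R]_d) : R :=
  \sum_(i < d) x ord0 i * y ord0 i.

Definition enorm (R : realType) (d : nat) (x : 'rV[R]_d) : R :=
  Num.sqrt (dot x x).

Definition eball (R : realType) (d : nat) (x : 'rV[R]_d) (r : R) :
    set 'rV[R]_d := [set y | enorm (y - x) < r].

Section levy.
Context (R : realType) (d : nat) (dO : measure_display)
  (Omega : measurableType dO) (P : probability Omega R).
Local Notation Rd := 'rV[R]_d.
Local Notation leb := (lebesgue_rV R d).
Implicit Types (X : R -> Omega -> Rd) (nu V : Rd -> R).

Definition cadlag (f : R -> Rd) : Prop :=
  (forall t, 0 <= t -> f s @[s --> t^'+] --> f t) /\
  (forall t, 0 < t -> cvg (f s @[s --> t^'-])).

Definition independent_increments X : Prop :=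
  forall (n : nat) (t : nat -> R) (B : nat -> set Rd),
    0 <= t 0%N -> (forall i, t i <= t i.+1) -> (forall i, measurable (B i)) ->
    P (\bigcap_(i in `I_n) [set w | B i (X (t i.+1) w - X (t i) w)%R]) =
    (\prod_(i < n) P [set w | B i (X (t i.+1) w - X (t i) w)%R])%E.

Definition stationary_increments X : Prop :=
  forall (s t : R) (B : set Rd), 0 <= s -> s <= t -> measurable B ->
    P [set w | B (X t w - X s w)] = P [set w | B (X (t - s) w)].

(* A Lévy process started at 0; only the times [0 <= t] matter. The laws
   [P^x] are those of [fun t w => x + X t w] under [P]. *)
Definition levy_process X : Prop :=
  [/\ forall t, 0 <= t -> measurable_fun setT (X t),
      {ae P, forall w, X 0 w = 0},
      independent_increments X,
      stationary_increments X &
      {ae P, forall w, cadlag (X^~ w)}].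

(* Real and imaginary parts of the Lévy-Khintchine exponent
   - i b.xi + xi.A xi / 2
     + \int (1 - exp (i xi.z) + i xi.z 1_{|z| < 1}) N(dz). *)
Definition re_exponent (A : 'M[R]_d) (N : {measure set Rd -> \bar R})
    (xi : Rd) : R :=
  dot xi (xi *m A) / 2 + \int[N]_z (1 - cos (dot xi z)).

Definition im_exponent (b : Rd) (N : {measure set Rd -> \bar R})
    (xi : Rd) : R :=
  - dot b xi +
  \int[N]_z ((if enorm z < 1 then dot xi z else 0) - sin (dot xi z)).

(* The last clause is E (exp (i xi.X_t)) = exp (- t psi(xi)), where psi is the
   exponent above, split into its real and imaginary parts. *)
Definition is_levy_measure X (N : {measure set Rd -> \bar R}) : Prop :=
  [/\ N [set 0] = 0%E,
      (\int[N]_z (Num.min 1 (enorm z ^+ 2))%:E < +oo)%E &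
      exists (b : Rd) (A : 'M[R]_d),
        [/\ A^T = A,
            forall xi : Rd, 0 <= dot xi (xi *m A) &
            forall (t : R) (xi : Rd), 0 <= t ->
              \int[P]_w cos (dot xi (X t w)) =
                expR (- t * re_exponent A N xi) * cos (t * im_exponent b N xi)
              /\
              \int[P]_w sin (dot xi (X t w)) =
                - expR (- t * re_exponent A N xi) *
                sin (t * im_exponent b N xi)]].

(* The Lévy measure of [X] has the strictly positive density [nu] on
   [R^d \ {0}]; the value [nu 0] is irrelevant. *)
Definition jump_intensity X nu : Prop :=
  [/\ measurable_fun setT nu,
      forall x, x != 0 -> 0 < nu x &
      exists N : {measure set Rd -> \bar R}, is_levy_measure X N /\
        forall B : set Rd, measurable B -> ~ B 0 ->
          N B = (\int[leb]_(x in B) (nu x)%:E)%E].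

Definition symmetric_process X : Prop :=
  forall (t : R) (B : set Rd), 0 <= t -> measurable B ->
    P [set w | B (X t w)] = P [set w | B (- X t w)].

Definition condA1 X nu : Prop :=
  [/\ symmetric_process X,
      jump_intensity X nu,
      forall r : R, 0 < r -> r <= 1 / 2 -> exists C1 : R, 1 <= C1 /\
        forall x y : Rd, r <= enorm y -> enorm y <= enorm x ->
          enorm x <= enorm y + 1 ->
          C1^-1 * nu y <= nu x /\ nu x <= C1 * nu y,
      exists C2 : R, 1 <= C2 /\
        forall x y : Rd, 1 / 2 <= enorm y -> enorm y <= enorm x ->
          nu x <= C2 * nu y &
      exists C3 : R, 1 <= C3 /\
        forall x y : Rd, 1 <= enorm (y - x) ->
          (\int[leb]_(z in [set z | 1 / 2 < enorm (z - x) /\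
                                    1 / 2 < enorm (z - y)]%R)
             (nu (x - z) * nu (z - y))%:E <= (C3 * nu (x - y))%:E)%E].

Definition strong_feller X : Prop :=
  forall (t : R) (f : Rd -> R), 0 < t -> measurable_fun setT f ->
    (exists M, forall x, `|f x| <= M) ->
    continuous (fun x => \int[P]_w f (x + X t w)).

(* Densities are only determined almost everywhere by the laws of the
   process; the Chapman-Kolmogorov equations at every point single out one
   version, which may take the value [+oo] (at 0 for small times). *)
Definition transition_density X (p : R -> Rd -> \bar R) : Prop :=
  [/\ forall t x, 0 < t -> (0 <= p t x)%E,
      forall t, 0 < t -> measurable_fun setT (p t),
      forall t (B : set Rd), 0 < t -> measurable B ->
        P [set w | B (X t w)] = (\int[leb]_(y in B) p t y)%E &
      forall s t x, 0 < s -> 0 < t ->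
        p (s + t) x = (\int[leb]_y (p s y * p t (x - y)%R))%E].

Definition condA2 X : Prop :=
  strong_feller X /\
  exists p : R -> Rd -> \bar R, transition_density X p /\
    exists tb C : R, 0 < tb /\ forall x, (0 < p tb x <= C%:E)%E.

Definition exit_time X (D : set Rd) (x : Rd) (w : Omega) : \bar R :=
  ereal_inf [set t%:E | t in [set t : R | 0 <= t /\ ~ D (x + X t w)]].

(* [q t x y] is p_D(t,x,y) for [x], [y] in [D]: the density of
   P^x(X_t \in dy, t < tau_D). As in [transition_density], symmetry and the
   Chapman-Kolmogorov equations at every point single out one version. The
   probability of the event is written as an integral since the event is in
   general measurable only with respect to the completion of [P]. *)
Definition killed_density X (D : set Rd) (q : R -> Rd -> Rd -> \bar R) :
    Prop :=
  [/\ forall t x y, 0 < t -> (0 <= q t x y)%E,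
      forall t x, 0 < t -> D x -> measurable_fun D (q t x),
      forall t x (B : set Rd), 0 < t -> D x -> measurable B -> B `<=` D ->
        (\int[P]_w (\1_[set w | B (x + X t w)%R /\
                                (t%:E < exit_time X D x w)%E] w)%:E =
         \int[leb]_(y in B) q t x y)%E,
      forall t x y, 0 < t -> D x -> D y -> q t x y = q t y x &
      forall s t x y, 0 < s -> 0 < t -> D x -> D y ->
        q (s + t) x y = (\int[leb]_(z in D) (q s x z * q t z y))%E].

Definition green_function (D : set Rd) (q : R -> Rd -> Rd -> \bar R)
    (x y : Rd) : \bar R :=
  if (x \in D) && (y \in D)
  then (\int[lebesgue_measure]_(t in `]0%R, +oo[%classic) q t x y)%E else 0%E.

Definition condA3 X : Prop :=
  forall p q r : R, 0 < p -> p < q -> q < r -> r <= 1 ->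
    exists pD : R -> Rd -> Rd -> \bar R, killed_density X (eball 0 r) pD /\
      (ereal_sup [set green_function (eball 0 r) pD x y |
                    x in eball 0 p & y in ~` eball 0 q] < +oo)%E.

Definition regular_jump_levy X nu : Prop :=
  [/\ levy_process X, condA1 X nu, condA2 X & condA3 X].

Definition kato X V : Prop :=
  measurable_fun setT V /\
  ereal_sup [set (\int[P]_w \int[lebesgue_measure]_(s in `[0%R, t]%classic)
                    (`|V (x + X s w)|)%:E)%E | x in setT]
    @[t --> 0^'+] --> 0%E.

Definition kato_loc X V : Prop :=
  forall (x : Rd) (r : R), kato X (fun y => V y * \1_(eball x r) y).

Definition kato_potential X V : Prop :=
  [/\ measurable_fun setT V, kato X V^\- & kato_loc X V^\+].

Definition confining V : Prop :=
  forall M : R, exists r : R, forall x, r < enorm x -> M < V x.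

Definition feynman_kac X V (t : R) (f : Rd -> R) (x : Rd) : R :=
  \int[P]_w (expR (- \int[lebesgue_measure]_(s in `[0, t]%classic)
                       V (x + X s w)) * f (x + X t w)).

Definition borderline_potential nu V : Prop :=
  exists t0 r : R, [/\ 0 < t0, 0 < r &
    forall x, (~` eball 0 r) x -> t0 * V x = `|ln (nu x)|].

Definition energy V nu (A : set Rd) : \bar R :=
  (\int[leb]_(x in A) (V x * nu x)%:E)%E.

Definition entropy nu (A : set Rd) : \bar R :=
  (- \int[leb]_(x in A) (nu x * ln (nu x))%:E)%E.

Definition free_energy V nu (A : set Rd) : \bar R :=
  (energy V nu A - entropy nu A)%E.

End levy.

(* Main.v *)
(* The free energy of [A] is the integral of [(t0 V + ln nu) nu] over [A].
   The quasi-monotonicity of [nu] in (A1) bounds it above far from the origin,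
   so that [|ln nu| = t0 V -> +oo] forces [nu < 1], i.e. [|ln nu| = - ln nu],
   far out. Conversely, if all these integrals vanish then [t0 V = - ln nu]
   almost everywhere outside a ball, hence everywhere there by continuity and
   [nu > 0], and [- ln nu = |ln nu|] as soon as [V > 0]. *)
Require Import Defs.
From mathcomp Require Import all_boot all_order all_algebra.
From mathcomp Require Import all_classical all_reals all_analysis.
From mathcomp Require Import measurable_realfun.
Import Order.TTheory GRing.Theory Num.Theory.
Import numFieldNormedType.Exports.
Local Open Scope classical_set_scope.
Local Open Scope ring_scope.

(** The library's [ball] is a sup-norm ball, hence a box, and its measure is a product of interval
    lengths [2 * e]. *)
Lemma lebesgue_rV_ball_gt0 {R : realType} {d : nat} (x : 'rV[R]_d) (e : R) :
  0 < e -> (0 < lebesgue_rV R d (ball x e))%E.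
Proof.
move=> e0.
have -> : ball x e = [set y | forall i, ball (x ord0 i) e (y ord0 i)].
  apply/seteqP; split=> y /= xy; first by move=> i; case: xy => _; exact.
  by split=> // i j; rewrite !ord1; exact: xy.
rewrite (lebesgue_rV_box (A := fun i => ball (x ord0 i) e)) => [|i]; last first.
  exact: measurable_ball.
elim/big_ind : _ => // [y z y0 z0|i _]; first exact: mule_gt0.
by rewrite lebesgue_measure_ball ?ltW// lte_fin mulrn_wgt0.
Qed.

Lemma lebesgue_rV_nbhs_nonnegligible {R : realType} {d : nat} {x : 'rV[R]_d}
    {A : set 'rV[R]_d} :
  nbhs x A -> ~ (lebesgue_rV R d).-negligible A.
Proof.
move=> /nbhs_ballP[e /= e0 eA] /(negligibleS eA).
move/negligibleP => /(_ (open_measurable_rV (ball_open x e))) xe0.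
by have := lebesgue_rV_ball_gt0 x e e0; rewrite xe0 ltxx.
Qed.

(** If the values at [x] differed, continuity would make [f] and [g] differ on a whole neighbourhood
    of [x] inside [D], which is not negligible. *)
Lemma ae_eq_continuous_at {R : realType} {d : nat} {D : set 'rV[R]_d}
    {f g : 'rV[R]_d -> R} {x : 'rV[R]_d} :
  nbhs x D -> {for x, continuous f} -> {for x, continuous g} ->
  ae_eq (lebesgue_rV R d) D (EFin \o f) (EFin \o g) -> f x = g x.
Proof.
move=> xD cf cg fg; apply/eqP; rewrite -subr_eq0; apply/negP => /negP fgx.
have fg_neq0 : \forall y \near x, f y - g y != 0.
  have cfg : f y - g y @[y --> x] --> f x - g x := cvgB cf cg.
  have := cfg _ [set s | s != 0]; apply.
  by apply: open_nbhs_nbhs; split => //; exact: open_neq.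
apply: (lebesgue_rV_nbhs_nonnegligible _ fg).
apply: filterS2 xD fg_neq0 => y Dy /eqP fgy /= /(_ Dy)[fgyE].
by apply: fgy; rewrite fgyE subrr.
Qed.

Lemma enorm_continuous (R : realType) (d : nat) : continuous (@enorm R d).
Proof.
move=> x; apply: (@continuous_comp _ _ _ (fun y => dot y y)); last first.
  exact: sqrt_continuous.
(* The index list is generalised so that the sum can be treated by induction. *)
suff: forall s : seq 'I_d,
  continuous (fun y : 'rV[R]_d => \sum_(i <- s) y ord0 i * y ord0 i) by exact.
elim=> [|i s IHs].
  by under eq_fun do rewrite big_nil; exact: cst_continuous.
under eq_fun do rewrite big_cons.
move=> y; have ci := @coord_continuous R 1 d ord0 i y.
exact: (cvgD (cvgM ci ci) (IHs y)).
Qed.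

Lemma enorm0 {R : realType} {d : nat} : enorm (0 : 'rV[R]_d) = 0.
Proof.
by rewrite /enorm /dot big1 ?sqrtr0// => i _; rewrite mxE mul0r.
Qed.

(** The norm is the square root of [d]. This vector later serves as the reference point in the
    quasi-monotonicity of [nu]. *)
Lemma enorm_const1 (R : realType) (d : nat) : (0 < d)%N ->
  1 <= enorm (const_mx 1 : 'rV[R]_d).
Proof.
move=> d0; rewrite /enorm /dot (eq_bigr (fun=> 1)) => [|i _]; last first.
  by rewrite !mxE mulr1.
by rewrite sumr_const card_ord -{1}[1]sqrtr1 ler_wsqrtr// ler1n.
Qed.

Lemma notin_eball0 {R : realType} {d : nat} (x : 'rV[R]_d) (r : R) :
  (~` eball 0 r) x <-> r <= enorm x.
Proof. by rewrite /eball/= subr0 leNgt; split=> /negP. Qed.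

Lemma measurable_notin_eball0 {R : realType} {d : nat} (r : R) :
  measurable (~` eball (0 : 'rV[R]_d) r).
Proof.
apply: measurableC; apply: open_measurable_rV.
have -> : eball 0 r = @enorm R d @^-1` [set s | s < r].
  by apply/funext => x /=; rewrite /eball/= subr0.
have /continuousP := @enorm_continuous R d; apply; exact: open_lt.
Qed.

Lemma nbhs_notin_eball0 {R : realType} {d : nat} {x : 'rV[R]_d} {r : R} :
  r < enorm x -> nbhs x (~` eball 0 r).
Proof.
move=> rx; have : \forall y \near x, r < enorm y.
  exact: enorm_continuous (lt_nbhsr rx).
by apply: filterS => y ry; apply/notin_eball0; exact: ltW.
Qed.

(** The energy may be infinite, but the entropy is finite by integrability and can be moved to the
    other side. The resulting equality of integrals is the form used by [integral_ae_eq]. *)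
Lemma free_energy_eq0 {R : realType} {d : nat} (V nu : 'rV[R]_d -> R)
    (A : set 'rV[R]_d) :
  measurable A ->
  (lebesgue_rV R d).-integrable A (fun x => (ln (nu x) * nu x)%:E) ->
  free_energy V nu A = 0%E <->
  (\int[lebesgue_rV R d]_(x in A) (- (ln (nu x) * nu x))%:E =
   \int[lebesgue_rV R d]_(x in A) (V x * nu x)%:E)%E.
Proof.
move=> mA il; have il_fin := integrable_fin_num mA il.
rewrite /free_energy /energy /entropy oppeK.
rewrite [X in (_ + X)%E](_ : _ =
    \int[lebesgue_rV R d]_(x in A) (ln (nu x) * nu x)%:E)%E; last first.
  by apply: eq_integral => x _; rewrite mulrC.
rewrite [X in _ <-> X = _](_ : _ =
    \int[lebesgue_rV R d]_(x in A) - (ln (nu x) * nu x)%:E)%E; last first.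
  by apply: eq_integral => x _; rewrite EFinN.
rewrite integralN; last first.
  by rewrite fin_num_adde_defl// fin_numN integrable_neg_fin_num.
split=> [EI0|<-]; last by rewrite addeC subee.
by apply/eqP; rewrite -sub0e sube_eq ?EI0// fin_num_adde_defl.
Qed.

Theorem corollary2p4 (R : realType) (d : nat) (d_gt0 : (0 < d)%N)
    (dO : measure_display) (Omega : measurableType dO)
    (P : probability Omega R) (X : R -> Omega -> 'rV[R]_d)
    (nu V : 'rV[R]_d -> R)
    (T : R -> ('rV[R]_d -> R) -> 'rV[R]_d -> R)
    (regX : regular_jump_levy P X nu)
    (katoV : kato_potential P X V) (confV : confining V)
    (TE : T = feynman_kac P X V)
    (log_nu_L1 : forall r : R, 0 < r ->
      (lebesgue_rV R d).-integrable (~` eball 0 r)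
        (fun x => (ln (nu x) * nu x)%:E))
    (nu_cont : forall x, x != 0 -> {for x, continuous nu})
    (V_cont : continuous V) :
  borderline_potential nu V <->
  exists t0 r : R, [/\ 0 < t0, 0 < r &
    forall A : set 'rV[R]_d, measurable A -> A `<=` ~` eball 0 r ->
      free_energy (fun x => t0 * V x) nu A = 0%E].
Proof.
case: regX => _ [_ [mnu nu_gt0 _] _ [C2 [C2_ge1 nuC2]] _] _ _.
have [mV _ _] := katoV.
have nonzero (x : 'rV[R]_d) : 0 < enorm x -> x != 0.
  by apply: contraTneq => ->; rewrite enorm0 ltxx.
split=> [[t0 [r [t0_gt0 r_gt0 t0V]]]|[t0 [r [t0_gt0 r_gt0 F0]]]].
  have one_gt0 : 0 < enorm (const_mx 1 : 'rV[R]_d).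
    exact: lt_le_trans (enorm_const1 R d d_gt0).
  pose e : 'rV[R]_d := const_mx 1.
  have [s Vs] := confV (t0^-1 * `|ln (C2 * nu e)|).
  (* Beyond [r] the borderline identity holds, from [s + 1] on the norm strictly exceeds [s], and
     beyond [enorm e] the bound [nu x <= C2 * nu e] applies. *)
  pose r' := Num.max r (Num.max (s + 1) (enorm e)).
  have r'_gt0 : 0 < r' by rewrite !lt_max r_gt0.
  exists t0, r'; split=> // A mA Ar'.
  have t0VE x : A x -> t0 * V x = - ln (nu x).
    move=> /Ar' /notin_eball0; rewrite !ge_max => /and3P[rx sx ex].
    have x0 : 0 < enorm x by exact: lt_le_trans ex.
    have nux0 := nu_gt0 _ (nonzero _ x0).
    rewrite t0V; last exact/notin_eball0.
    (* If [ln (nu x)] were positive, it would equal [t0 * V x] and exceed [ln (C2 * nu e)] by the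
       choice of [s], against the bound on [nu x]. *)
    apply: ler0_norm; rewrite leNgt; apply/negP => lnx_gt0.
    have : `|ln (C2 * nu e)| < `|ln (nu x)|.
      rewrite -t0V; last exact/notin_eball0.
      by rewrite -ltr_pdivrMl// Vs// (lt_le_trans _ sx)// ltrDl.
    rewrite (gtr0_norm lnx_gt0); apply/negP; rewrite -leNgt.
    apply: le_trans (ler_norm _); rewrite ler_ln ?posrE//; last first.
      by rewrite mulr_gt0 ?nu_gt0 ?nonzero// (lt_le_trans _ C2_ge1).
    apply: nuC2 => //; apply: le_trans (enorm_const1 R d d_gt0).
    by rewrite ler_pdivrMr// mul1r ler1n.
  apply/(free_energy_eq0 _ _ _ mA).
    apply: integrableS (log_nu_L1 _ r'_gt0) => //.
    exact: measurable_notin_eball0.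
  by apply: eq_integral => x /set_mem Ax; rewrite t0VE// mulNr.
pose D : set 'rV[R]_d := ~` eball 0 r.
have mD : measurable D by exact: measurable_notin_eball0.
have ilD := log_nu_L1 _ r_gt0.
(* Equal integrals over every measurable subset of [D] force equality almost everywhere;
   integrability is required only of the logarithmic side. *)
have ae : ae_eq (lebesgue_rV R d) D (EFin \o (fun x => - (ln (nu x) * nu x)))
    (EFin \o (fun x => t0 * V x * nu x)).
  apply: integral_ae_eq => //.
  - exact: integrableN ilD.
  - apply/measurable_EFinP; apply: measurable_funTS.
    by apply: measurable_funM => //; apply: measurable_funM.
  - move=> A AD mA; apply/(free_energy_eq0 _ _ _ mA); last exact: F0.
    exact: integrableS ilD.
(* The strict inequality places [x] in the interior of [D], where the almost everywhere identity
   extends by continuity; then [nu x > 0] is cancelled. *)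
have t0VE x : r < enorm x -> t0 * V x = - ln (nu x).
  move=> rx; have x0 := nonzero _ (lt_trans r_gt0 rx).
  have nux0 := nu_gt0 _ x0.
  have cln : {for x, continuous (fun y => ln (nu y))}.
    by apply: continuous_comp; [exact: nu_cont|exact: continuous_ln].
  have : - (ln (nu x) * nu x) = t0 * V x * nu x.
    apply: (ae_eq_continuous_at (nbhs_notin_eball0 rx) _ _ ae).
      by apply: continuousN; apply: continuousM => //; exact: nu_cont.
    apply: continuousM; last exact: nu_cont.
    by apply: continuousM; [exact: cst_continuous|exact: V_cont].
  by rewrite -mulNr => /(mulIf (lt0r_neq0 nux0)).
have [s Vs] := confV 0.
(* Adding 1 turns the weak inequality on the complement of an open ball into the strict ones needed
   for [t0VE] and for [V x > 0]. *)
exists t0, (Num.max (r + 1) (s + 1)); split=> //.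
  by rewrite lt_max addr_gt0.
move=> x /notin_eball0; rewrite ge_max => /andP[rx sx].
have Vx0 : 0 < V x by rewrite Vs// (lt_le_trans _ sx)// ltrDl.
rewrite -normrN -t0VE; last by rewrite (lt_le_trans _ rx)// ltrDl.
by rewrite gtr0_norm// mulr_gt0.
Qed.
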